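(* Let $X$ be a real Banach space, and let $f:[a,b]\to X$ be continuous, of finite variation, and not constant on any (nondegenerate) subinterval of $[a,b]$. Let $x\in(a,b)$, $y=v_f(x)$, and $g=f\circ v_f^{-1}$. Then (i) if $x$ is a metrically regular point of $f$, then $md(g,y)=1$; (ii) if $x$ is a bilaterally metrically regular point of $f$, and there exists a neighbourhood $U$ of $x$ such that all $z\in U$ are metrically regular points of $f$, then $g$ is metrically differentiable at $y$.
   Context: $\bigvee_u^v f$ denotes the total variation of $f$ on $[u,v]$ for $u<v$, and $\bigvee_v^u f:=-\bigvee_u^v f$; $f$ has finite variation if $\bigvee_a^b f<\infty$. $v_f(x):=\bigvee_a^x f$ for $x\in[a,b]$; under the hypotheses $v_f$ is a homeomorphism of $[a,b]$ onto $[0,v_f(b)]$. A point $x\in[a,b]$ is a metrically regular point of $f$ if $\lim_{t\to0,\ x+t\in[a,b]}\frac{\|f(x+t)-f(x)\|}{\left|\bigvee_x^{x+t}f\right|}=1$. It is a bilaterally metrically regular point of $f$ if $\frac{\|f(u)-f(w)\|}{\bigvee_u^w f}\to1$ as $(u,w)\to(x,x)$ with $a\le u\le x\le w\le b$, $(u,w)\neq(x,x)$. For a mapping $g$ from an interval to $X$ and an interior point $y$, the metric derivative $md(g,y)$ is the common value of $\lim_{t\to0+}\frac{\|g(y+t)-g(y)\|}{t}$ and $\lim_{t\to0+}\frac{\|g(y-t)-g(y)\|}{t}$ if both limits exist and are equal (and finite). The mapping $g$ is metrically differentiable at $y$ if $md(g,y)$ exists and $\|g(s)-g(t)\|-md(g,y)|s-t|=o(|s-y|+|t-y|)$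 as $(s,t)\to(y,y)$. *)

(* Defs.v *)
From HB Require Import structures.
From mathcomp Require Import all_boot all_order all_algebra.
From mathcomp Require Import all_classical all_reals all_analysis.

Set Implicit Arguments.
Unset Strict Implicit.
Unset Printing Implicit Defensive.

Import Order.TTheory GRing.Theory Num.Theory.
Import numFieldNormedType.Exports.

Local Open Scope classical_set_scope.
Local Open Scope ring_scope.

(* The library's [variation] and [total_variation] are restricted to functions
   R -> R; the same formulas are used here for values in a normed module. A
   mapping defined on [a, b] is a total function R -> X of which only the values
   on [a, b] are used. *)
Section variation.
Context {R : realType} {X : normedModType R}.
Implicit Types (a b u v x : R) (f : R -> X).

Definition vvariation a b f (s : seq R) : R :=
  let F := f \o nth b (a :: s) in \sum_(0 <= n < size s) `|F n.+1 - F n|.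

Definition vtotal_variation a b f : \bar R :=
  ereal_sup [set (vvariation a b f s)%:E | s in itv_partition a b].

Definition finite_variation a b f : Prop := (vtotal_variation a b f < +oo)%E.

(* The oriented variation: the variation over [u, v] if u <= v, and the opposite
   of the variation over [v, u] otherwise. [fine] sends infinite values to 0,
   so this is meaningful only where the variation is finite. *)
Definition oriented_variation u v f : R :=
  if u <= v then fine (vtotal_variation u v f)
  else - fine (vtotal_variation v u f).

Definition variation_function a f x : R := oriented_variation a x f.

(* The inverse of v_f : [a, b] -> [0, v_f(b)]; outside the image of [a, b] it
   takes the default value a. *)
Definition variation_function_inv a b f : R -> R :=
  'pinv_(fun=> a) `[a, b] (variation_function a f).

Definition nonconstant_on_subintervals a b f : Prop :=
  forall c d, a <= c -> c < d -> d <= b ->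
    ~ exists k : X, forall t, t \in `[c, d] -> f t = k.

Definition metrically_regular a b f x : Prop :=
  x \in `[a, b] /\
  `|f (x + t) - f x| / `|oriented_variation x (x + t) f|
    @[t --> within [set t | x + t \in `[a, b]] (0 : R)^'] --> (1 : R).

Definition bilaterally_metrically_regular a b f x : Prop :=
  x \in `[a, b] /\
  `|f p.1 - f p.2| / oriented_variation p.1 p.2 f
    @[p --> within [set p : R * R | a <= p.1 <= x /\ x <= p.2 <= b] (x, x)^']
    --> (1 : R).

End variation.

(* As y is an interior point of the domain of g, the notions below depend only
   on the values of g near y, so that g is taken to be a total function. *)
Section metric_derivative.
Context {R : realType} {X : normedModType R}.
Implicit Types (g : R -> X) (y m : R).

Definition is_metric_derivative g y m : Prop :=
  (`|g (y + t) - g y| / t @[t --> (0 : R)^'+] --> m) /\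
  (`|g (y - t) - g y| / t @[t --> (0 : R)^'+] --> m).

Definition metrically_differentiable g y : Prop :=
  exists m, is_metric_derivative g y m /\
    (fun p : R * R => `|g p.1 - g p.2| - m * `|p.1 - p.2|)
      =o_ ((y, y) : R * R) (fun p : R * R => `|p.1 - y| + `|p.2 - y|).

End metric_derivative.

(* Main.v *)
(** Put [y = v_f x] and [g = f o v_f^-1]. In the coordinate [s = v_f u], the
    variation of [f] between [u] and [w] is the length [|s - t|], so [g] is
    1-Lipschitz and (bilateral) metric regularity of [f] at [x] says that
    [|g s - g t| / |s - t|] tends to 1 as [s] and [t] tend to [y] with [t = y]
    (resp. with [s <= y <= t]). Part (i) is the former. For (ii), when [s] and
    [t] lie on the same side of [y] and [|t - y| <= |s - y|], then
      [|g s - g t| >= |g s - g y| - |g t - g y|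
                   >= (1 - e) |s - y| - |t - y| = |s - t| - e |s - y|].
    The change of coordinate rests on [v_f] being additive, continuous and
    strictly increasing. *)
Require Import Defs.
From HB Require Import structures.
From mathcomp Require Import all_boot all_order all_algebra.
From mathcomp Require Import all_classical all_reals all_analysis.
From mathcomp Require Import lra.

Set Implicit Arguments.
Unset Strict Implicit.
Unset Printing Implicit Defensive.

Import Order.TTheory GRing.Theory Num.Theory.
Import numFieldNormedType.Exports.

Local Open Scope classical_set_scope.
Local Open Scope ring_scope.

(** * Total variation of a vector-valued function: additivity over adjacent intervals *)

Section total_variation_theory.
Context {R : realType} {X : normedModType R}.
Variable f : R -> X.
Implicit Types (a b c u w z : R) (s : seq R).

Local Notation TV u w := (vtotal_variation u w f).

Lemma vvariation_nil a b : vvariation a b f [::] = 0.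
Proof. by rewrite /vvariation big_nil. Qed.

Lemma vvariation_cons a b c s :
  vvariation a b f (c :: s) = `|f c - f a| + vvariation c b f s.
Proof. by rewrite /vvariation /= big_nat_recl. Qed.

Lemma vvariation_cat a b c s t : itv_partition a c s ->
  vvariation a b f (s ++ t) = vvariation a c f s + vvariation c b f t.
Proof.
elim: s a => [a /itv_partition_nil ->|d s IH a /itv_partition_cons ps].
  by rewrite vvariation_nil add0r.
by rewrite cat_cons !vvariation_cons IH// addrA.
Qed.

Lemma itv_partition_exists a b : a <= b -> exists s, itv_partition a b s.
Proof.
rewrite le_eqVlt => /predU1P[->|ab]; first by exists [::]; split.
by exists [:: b]; exact: itv_partition1.
Qed.

Lemma vvariation_le a b s : itv_partition a b s ->
  ((vvariation a b f s)%:E <= TV a b)%E.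
Proof. by move=> ps; apply: ereal_sup_ubound; exists s. Qed.

Lemma dist_le_vtotal_variation a b : a <= b ->
  (`|f b - f a|%:E <= TV a b)%E.
Proof.
rewrite le_eqVlt => /predU1P[->|ab].
  rewrite subrr normr0 -(vvariation_nil b b); apply: vvariation_le.
  by split.
have := @vvariation_le a b [:: b] (itv_partition1 ab).
by rewrite vvariation_cons vvariation_nil addr0.
Qed.

Lemma vtotal_variation_ge0 a b : a <= b -> (0 <= TV a b)%E.
Proof.
by move=> ab; apply: le_trans (dist_le_vtotal_variation ab); rewrite lee_fin.
Qed.

(** Partitions of [[a, c]] and [[c, b]] concatenate to one of [[a, b]]. The two suprema are taken
    one after the other, and the second one moves the variation over [[c, b]] across the inequality,
    so it must be finite there. *)
Lemma vtotal_variation_superadditive a c b : a <= c -> c <= b ->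
  (TV a c + TV c b <= TV a b)%E.
Proof.
move=> ac cb.
have part s : itv_partition a c s ->
    ((vvariation a c f s)%:E + TV c b <= TV a b)%E.
  move=> ps; rewrite addeC -leeBrDr//; apply: ge_ereal_sup => _ [t pt <-].
  rewrite leeBrDr// -EFinD addrC -vvariation_cat//.
  exact/vvariation_le/itv_partition_cat/pt.
have [s0 ps0] := itv_partition_exists ac.
have [fin|] := boolP (TV c b \is a fin_num).
  rewrite -leeBrDr//; apply: ge_ereal_sup => _ [s ps <-].
  by rewrite leeBrDr//; exact: part.
rewrite ge0_fin_numE ?vtotal_variation_ge0// -leNgt leye_eq => /eqP cboo.
(* With infinite variation over [[c, b]], any single partition [s0] of [[a, c]] already forces
   infinite variation over [[a, b]]. *)
have := part _ ps0; rewrite cboo addey// leye_eq => /eqP ->.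
exact: leey.
Qed.

Lemma dist_add_vtotal_variation_le a c b : a <= c -> c <= b ->
  (`|f c - f a|%:E + TV c b <= TV a b)%E.
Proof.
move=> ac cb; apply: le_trans (vtotal_variation_superadditive ac cb).
by rewrite leeD2r// dist_le_vtotal_variation.
Qed.

(* With [u = w] this is subadditivity of the variation; for [u < w] it forces
   the variation over a gap of a nearly optimal partition to be close to the
   increment, which gives continuity of the variation function. *)
Lemma vvariation_gap_le a b u w s : itv_partition a b s ->
  a <= u -> u <= w -> w <= b -> {in s, forall c, ~~ (u < c < w)} ->
  ((vvariation a b f s)%:E <= TV a u + `|f w - f u|%:E + TV w b)%E.
Proof.
elim: s a => [a|c s IH a] pcs au uw wb gap.
  by rewrite vvariation_nil !adde_ge0// ?lee_fin// vtotal_variation_ge0.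
have [pacs _] := pcs; have /= /andP[ac _] := pacs.
have ps := itv_partition_cons pcs; have cb := itv_partition_le ps.
(* If the first point [c] is at or beyond [w], the chord from [a] to [c] spans the gap and is split
   at [u] and [w]. Otherwise [c <= u], since no partition point lies inside the gap, and the
   induction continues from [c]. *)
rewrite vvariation_cons; have [wc|cw] := leP w c.
  apply: (@le_trans _ _ (`|f u - f a|%:E + `|f w - f u|%:E
                         + (`|f c - f w| + vvariation c b f s)%:E)%E).
    rewrite -!EFinD lee_fin.
    have := ler_distD (f u) (f c) (f a); have := ler_distD (f w) (f c) (f u).
    lra.
  rewrite leeD//; first by rewrite leeD2r// dist_le_vtotal_variation.
  apply: le_trans (dist_add_vtotal_variation_le wc cb).
  by rewrite EFinD leeD2l// vvariation_le.
have cu : c <= u.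
  by rewrite leNgt; apply/negP => uc; have := gap c (mem_head _ _); rewrite uc cw.
apply: (@le_trans _ _
  (`|f c - f a|%:E + (TV c u + `|f w - f u|%:E + TV w b))%E).
  rewrite EFinD leeD2l// IH// => d ds; apply: gap; by rewrite inE ds orbT.
by rewrite !addeA !leeD2r// dist_add_vtotal_variation_le// ltW.
Qed.

Lemma vtotal_variationD a c b : a <= c -> c <= b ->
  (TV a c + TV c b = TV a b)%E.
Proof.
move=> ac cb; apply/eqP; rewrite eq_le vtotal_variation_superadditive//=.
apply: ge_ereal_sup => _ [s ps <-].
have := @vvariation_gap_le a b c c s ps ac (lexx _) cb.
rewrite subrr normr0 adde0; apply => d _.
by apply/negP => /andP[cd /(lt_trans cd)]; rewrite ltxx.
Qed.

End total_variation_theory.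

(** * The variation function: continuity, strict monotonicity and continuity of its inverse *)

Section variation_function_theory.
Context {R : realType} {X : normedModType R}.
Variables (a b : R) (f : R -> X).
Hypothesis f_fv : finite_variation a b f.
Implicit Types (u w z : R).

Local Notation TV u w := (vtotal_variation u w f).
Local Notation v := (variation_function a f).

Lemma vtotal_variation_fin_num u w : a <= u -> u <= w -> w <= b ->
  TV u w \is a fin_num.
Proof.
move=> au uw wb; rewrite ge0_fin_numE ?vtotal_variation_ge0//.
apply: le_lt_trans f_fv.
rewrite -(vtotal_variationD f au (le_trans uw wb)) -(vtotal_variationD f uw wb).
by rewrite addeCA leeDl// adde_ge0 ?vtotal_variation_ge0.
Qed.

Lemma fine_vtotal_variationE u w : a <= u -> u <= w -> w <= b ->
  fine (TV u w) = v w - v u.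
Proof.
move=> au uw wb; rewrite /variation_function /oriented_variation.
rewrite au (le_trans au uw) -(vtotal_variationD f au uw) fineD.
- by rewrite addrAC subrr add0r.
- by rewrite vtotal_variation_fin_num// (le_trans uw).
- by rewrite vtotal_variation_fin_num.
Qed.

Lemma oriented_variationE u w : u \in `[a, b] -> w \in `[a, b] ->
  oriented_variation u w f = v w - v u.
Proof.
rewrite !in_itv/= => /andP[au ub] /andP[aw wb]; rewrite /oriented_variation.
have [uw|/ltW wu] := leP u w; first by rewrite fine_vtotal_variationE.
by rewrite fine_vtotal_variationE// opprB.
Qed.

Lemma dist_le_variation_function u w : u \in `[a, b] -> w \in `[a, b] ->
  `|f u - f w| <= `|v u - v w|.
Proof.
wlog uw : u w / w <= u.
  move=> W uab wab; have [wu|/ltW uw] := leP w u; first exact: W.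
  by rewrite distrC [leRHS]distrC; exact: W.
rewrite !in_itv/= => /andP[au ub] /andP[aw wb].
rewrite -fine_vtotal_variationE//; apply: le_trans (ler_norm _).
rewrite -lee_fin fineK ?vtotal_variation_fin_num//.
exact: dist_le_vtotal_variation.
Qed.

Lemma variation_function_nondecreasing u w :
  a <= u -> u <= w -> w <= b -> v u <= v w.
Proof.
move=> au uw wb; rewrite -subr_ge0 -fine_vtotal_variationE//.
by rewrite fine_ge0// vtotal_variation_ge0.
Qed.

(** A point [c] of the list that is farther from [z] than [t] cannot lie strictly between [z] and
    [t]; [z] itself may be in the list. *)
Lemma near_no_point_between (s : seq R) z : \forall t \near z,
  all (fun c => (c == z) || (`|t - z| < `|c - z|)) s.
Proof.
elim: s => [|c s IH]; first by near=> t.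
have cP : c != z -> \forall t \near z, `|t - z| < `|c - z|.
  rewrite -subr_eq0 -normr_gt0 => cz.
  exact: (@cvgr_distC_lt _ _ _ (nbhs z) _ id z cvg_id).
have [cz|cz] := eqVneq c z; first by near=> t => /=; rewrite cz eqxx; near: t.
by near=> t => /=; apply/andP; split; [apply/orP; right|];
  near: t; [exact: cP|].
Unshelve. all: by end_near. Qed.

Lemma variation_function_continuous : {within `[a, b], continuous f} ->
  {within `[a, b], continuous v}.
Proof.
move=> /subspace_continuousP fc; apply/subspace_continuousP => z zab.
have /= := zab; rewrite in_itv/= => /andP[az zb].
have ab := le_trans az zb.
apply/cvgrPdist_le => e e0.
have e20 : 0 < e / 2 by lra.
have fab : TV a b \is a fin_num by rewrite vtotal_variation_fin_num.
have [_ [s ps <-] sub] := ub_ereal_sup_adherent e20 fab.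
(* The partition [s] is within [e / 2] of the total variation, so over an interval free of its
   points the variation exceeds the increment of [f] by at most [e / 2]. Continuity of [f] supplies
   the other half. *)
have gap u w : a <= u -> u <= w -> w <= b -> {in s, forall c, ~~ (u < c < w)} ->
    v w - v u <= `|f w - f u| + e / 2.
  move=> au uw wb nos.
  have := lt_le_trans sub (vvariation_gap_le f ps au uw wb nos).
  have aw := le_trans au uw; have ub := le_trans uw wb.
  rewrite -[ereal_sup _]/(TV a b) -(fineK fab).
  rewrite -(fineK (vtotal_variation_fin_num (lexx a) au ub)).
  rewrite -(fineK (vtotal_variation_fin_num aw wb (lexx b))).
  rewrite -!EFinD lte_fin !fine_vtotal_variationE//; lra.
have fcz := fc _ zab; move/cvgrPdist_le : fcz => /(_ _ e20) fcz.
near=> t.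
have tab : t \in `[a, b] by near: t; exact: withinT.
have := tab; rewrite in_itv/= => /andP[at_ tb].
have ftz : `|f z - f t| <= e / 2 by near: t.
have /allP nos : all (fun c => (c == z) || (`|t - z| < `|c - z|)) s.
  by near: t; apply: cvg_within; exact: near_no_point_between.
have [tz|/ltW zt] := leP t z.
  rewrite ger0_norm ?subr_ge0 ?variation_function_nondecreasing//.
  apply: le_trans (gap _ _ _ _ _ _) _ => //; last by lra.
  move=> c /nos /orP[/eqP ->|]; first by rewrite ltxx andbF.
  move=> H; apply/negP => /andP[tc cz]; move: H.
  rewrite !ler0_norm ?subr_le0// ?(ltW cz)//; lra.
rewrite distrC ger0_norm ?subr_ge0 ?variation_function_nondecreasing//.
apply: le_trans (gap _ _ _ _ _ _) _ => //; last by rewrite distrC; lra.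
move=> c /nos /orP[/eqP ->|]; first by rewrite ltxx.
move=> H; apply/negP => /andP[zc ct]; move: H.
rewrite !ger0_norm ?subr_ge0// ?(ltW zc)//; lra.
Unshelve. all: by end_near. Qed.

Hypothesis f_nonconst : nonconstant_on_subintervals a b f.

(** If [v u = v w], monotonicity makes [v] constant on [[u, w]]; since increments of [f] are bounded
    by those of [v], [f] would be constant there too. *)
Lemma variation_function_increasing u w :
  a <= u -> u < w -> w <= b -> v u < v w.
Proof.
move=> au uw wb; rewrite lt_neqAle variation_function_nondecreasing ?(ltW uw)//.
rewrite andbT; apply/eqP => vuw; apply: (f_nonconst au uw wb); exists (f u) => t.
rewrite in_itv/= => /andP[ut tw]; apply/eqP; rewrite -subr_eq0 -normr_le0.
have tb := le_trans tw wb; have ub := le_trans (ltW uw) wb.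
have at_ := le_trans au ut.
apply: le_trans (dist_le_variation_function _ _) _; rewrite ?in_itv/= ?at_ ?au//.
have := variation_function_nondecreasing au ut tb.
have := variation_function_nondecreasing at_ tw wb.
by rewrite -vuw => h1 h2; rewrite (@le_anti _ _ (v t) (v u)) ?h1// subrr normr0.
Qed.

Lemma variation_function_lt : {in `[a, b] &, {mono v : u w / u < w}}.
Proof.
apply: leW_mono_in; apply: le_mono_in => u w.
rewrite !in_itv/= => /andP[au ub] /andP[aw wb] uw.
exact: variation_function_increasing.
Qed.

Lemma variation_function_inj : {in `[a, b] &, injective v}.
Proof.
move=> u w uab wab vuw; apply/eqP; rewrite eq_le !leNgt.
rewrite -(variation_function_lt uab wab) -(variation_function_lt wab uab).
by rewrite vuw ltxx.
Qed.

Local Notation vinv := (variation_function_inv a b f).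

Lemma variation_functionK : {in `[a, b], cancel v vinv}.
Proof.
move=> u uab; apply: pinvKV; last by rewrite inE.
by move=> s t; rewrite !inE; exact: variation_function_inj.
Qed.

Hypothesis f_cont : {within `[a, b], continuous f}.

(** The intermediate value theorem gives a preimage of [s], and strict monotonicity places it
    between [u] and [w]. Taking [u = a], [w = b] shows that [vinv] inverts [v] near interior values;
    [u] and [w] close to [x] give continuity of [vinv]. *)
Lemma variation_function_invP u w s : a <= u -> u < w -> w <= b ->
  v u < s < v w -> u < vinv s < w /\ v (vinv s) = s.
Proof.
move=> au uw wb /andP[us sw].
have uab : u \in `[a, b] by rewrite in_itv/= au (le_trans (ltW uw)).
have wab : w \in `[a, b] by rewrite in_itv/= wb (le_trans au (ltW uw)).
have [||c cab vc] := @IVT R v a b s _ (variation_function_continuous f_cont).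
- exact: le_trans au (le_trans (ltW uw) wb).
- have va : v a <= v u.
    apply: variation_function_nondecreasing => //; exact: le_trans (ltW uw) wb.
  have vb : v w <= v b.
    apply: variation_function_nondecreasing => //; exact: le_trans au (ltW uw).
  by rewrite ge_min le_max; apply/andP; split; apply/orP; [left|right]; lra.
rewrite -vc variation_functionK// -(variation_function_lt uab cab).
by rewrite -(variation_function_lt cab wab) vc us sw.
Qed.

Lemma near_variation_function_inv x : x \in `]a, b[ ->
  \forall s \near v x, vinv s \in `[a, b] /\ v (vinv s) = s.
Proof.
rewrite in_itv/= => /andP[ax xb]; near=> s.
have [|/andP[as_ sb] ->] :=
    @variation_function_invP a b s (lexx _) (lt_trans ax xb) (lexx _).
  apply/andP; split; near: s; [apply: lt_nbhsr|apply: lt_nbhsl];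
    by apply: variation_function_increasing; rewrite // ltW.
by rewrite in_itv/= !ltW.
Unshelve. all: by end_near. Qed.

Lemma variation_function_inv_cvg x : x \in `]a, b[ -> vinv s @[s --> v x] --> x.
Proof.
rewrite in_itv/= => /andP[ax xb]; apply/cvgrPdist_lt => e e0.
(* The interval around [x] of radius [e], cut down to [[a, b]]. *)
pose u := Num.max a (x - e); pose w := Num.min b (x + e).
have au : a <= u by rewrite le_max lexx.
have wb : w <= b by rewrite ge_min lexx.
have ux : u < x by rewrite gt_max ax/=; lra.
have xw : x < w by rewrite lt_min xb/=; lra.
have eu : x - e <= u by rewrite le_max lexx orbT.
have we : w <= x + e by rewrite ge_min lexx orbT.
near=> s.
have [|/andP[us sw] _] := @variation_function_invP u w s au (lt_trans ux xw) wb.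
  apply/andP; split; near: s; [apply: lt_nbhsr|apply: lt_nbhsl];
    by apply: variation_function_increasing => //; exact: ltW.
rewrite ltr_norml; lra.
Unshelve. all: by end_near. Qed.

End variation_function_theory.

(** * Change to the arc-length coordinate and metric differentiability of [g] *)

Lemma cvg_into_within {T U : Type} (F : set_system T) (G : set_system U)
    (D : set U) (k : T -> U) : Filter F ->
  k @ F --> G -> (\forall t \near F, D (k t)) -> k @ F --> within D G.
Proof.
move=> FF kG kD P GP; have kP : \forall t \near F, D (k t) -> P (k t) := kG _ GP.
by apply: filterS2 kD kP => t Dk; exact.
Qed.

Section arclength_parametrization.
Context {R : realType} {X : normedModType R}.
Variables (a b : R) (f : R -> X) (x : R).
Hypotheses (f_cont : {within `[a, b], continuous f})
  (f_fv : finite_variation a b f)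
  (f_nonconst : nonconstant_on_subintervals a b f)
  (x_ab : x \in `]a, b[).

Local Notation v := (variation_function a f).
Local Notation vinv := (variation_function_inv a b f).
Local Notation y := (v x).
Local Notation g := (f \o vinv).

Let x_cc : x \in `[a, b].
Proof. exact: subset_itv_oo_cc x_ab. Qed.

Let vinvy : vinv y = x.
Proof. exact: (variation_functionK f_fv f_nonconst). Qed.

Let vinvP := near_variation_function_inv f_fv f_nonconst f_cont x_ab.
Let vinv_cvg := variation_function_inv_cvg f_fv f_nonconst f_cont x_ab.

Lemma arclength_lipschitz : \forall p \near (y, y),
  `|g p.1 - g p.2| <= `|p.1 - p.2|.
Proof.
near=> p.
have [p1ab p1K] : vinv p.1 \in `[a, b] /\ v (vinv p.1) = p.1.
  by near: p; exact: cvg_fst vinvP.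
have [p2ab p2K] : vinv p.2 \in `[a, b] /\ v (vinv p.2) = p.2.
  by near: p; exact: cvg_snd vinvP.
by have /= := dist_le_variation_function f_fv p1ab p2ab; rewrite p1K p2K.
Unshelve. all: by end_near. Qed.

(** Substitution of [t = vinv s - x] in the limit defining metric regularity: the oriented variation
    from [x] to [x + t] becomes [s - y]. *)
Lemma metrically_regular_arclength_cvg : metrically_regular a b f x ->
  `|g s - g y| / `|s - y| @[s --> y^'] --> (1 : R).
Proof.
move=> [_ reg].
have k_cvg : (vinv s - x) @[s --> y^'] -->
    within [set t | x + t \in `[a, b]] (0 : R)^'.
  apply: cvg_into_within.
    apply: cvg_into_within.
      rewrite -(subrr x); apply: cvgB; last exact: cvg_cst.
      exact: cvg_trans (cvg_app _ (@nbhs_dnbhs _ y)) vinv_cvg.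
    near=> s; rewrite /= subr_eq0; apply/eqP => sx.
    have [_ sK] : vinv s \in `[a, b] /\ v (vinv s) = s.
      by near: s; exact: nbhs_dnbhs vinvP.
    have : s != y by near: s; exact: nbhs_dnbhs_neq.
    by rewrite -sK sx eqxx.
  near=> s; rewrite /= addrCA subrr addr0.
  suff [] : vinv s \in `[a, b] /\ v (vinv s) = s by [].
  by near: s; exact: nbhs_dnbhs vinvP.
apply: cvg_trans (cvg_comp _ _ k_cvg reg); apply: near_eq_cvg.
near=> s.
have [sab sK] : vinv s \in `[a, b] /\ v (vinv s) = s.
  by near: s; exact: nbhs_dnbhs vinvP.
by rewrite /= addrCA subrr addr0 vinvy (oriented_variationE f_fv)// sK.
Unshelve. all: by end_near. Qed.

Lemma metrically_regular_metric_derivative :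
  metrically_regular a b f x -> is_metric_derivative g y 1.
Proof.
move=> /metrically_regular_arclength_cvg reg.
(* Both one-sided limits are the two-sided limit composed with [y + h t], for [h] the identity or
   the opposite. *)
have side (h : R -> R) : {homo h : t / 0 < t >-> t != 0} ->
    (forall t, `|h t| = `|t|) ->
    `|g (y + h t) - g y| / t @[t --> (0 : R)^'+] --> (1 : R).
  move=> h0 hn; have h_cvg : (y + h t) @[t --> (0 : R)^'+] --> y^'.
    apply: cvg_into_within; last first.
      near=> t; rewrite /= -subr_eq0 addrAC subrr add0r; apply: h0.
      by near: t; exact: nbhs_right_gt.
    apply/cvgrPdist_lt => e e0; near=> t.
    rewrite opprD addrA subrr sub0r normrN hn gtr0_norm; near: t.
      exact: nbhs_right_lt.
    exact: nbhs_right_gt.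
  apply: cvg_trans (cvg_comp _ _ h_cvg reg); apply: near_eq_cvg; near=> t.
  rewrite /= [X in `|X| ^-1]addrAC subrr add0r hn gtr0_norm//.
split; first by apply: (side id) => // t /lt0r_neq0.
by apply: (side -%R) => [t /lt0r_neq0|t]; rewrite ?oppr_eq0 ?normrN.
Unshelve. all: by end_near. Qed.

(** The same substitution in both variables. Strict monotonicity of [v] carries [p.1 <= y <= p.2] to
    the corresponding order around [x]. *)
Lemma bilaterally_metrically_regular_arclength_cvg :
  bilaterally_metrically_regular a b f x ->
  `|g p.1 - g p.2| / (p.2 - p.1)
    @[p --> within [set p : R * R | p.1 <= y <= p.2] (y, y)^'] --> (1 : R).
Proof.
move=> [_ reg]; set F := within _ _.
have FF : Filter F by exact: within_filter.
have F_cvg : F --> (y, y).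
  by apply: cvg_trans (@nbhs_dnbhs _ (y, y)); exact: cvg_within.
have invF1 : \forall p \near F, vinv p.1 \in `[a, b] /\ v (vinv p.1) = p.1.
  by apply: F_cvg; exact: cvg_fst vinvP.
have invF2 : \forall p \near F, vinv p.2 \in `[a, b] /\ v (vinv p.2) = p.2.
  by apply: F_cvg; exact: cvg_snd vinvP.
have neF : \forall p \near F, p != (y, y).
  by apply: cvg_within; exact: (@nbhs_dnbhs_neq (R * R)%type (y, y)).
have k_cvg : (vinv p.1, vinv p.2) @[p --> F] -->
    within [set p : R * R | a <= p.1 <= x /\ x <= p.2 <= b] (x, x)^'.
  apply: cvg_into_within.
    apply: cvg_into_within.
      apply: (@cvg_pair _ _ _ F (nbhs x) (nbhs x)).
        have F1 : p.1 @[p --> F] --> y.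
          by move=> A Ay; apply: F_cvg; exact: cvg_fst Ay.
        exact: cvg_comp F1 vinv_cvg.
      have F2 : p.2 @[p --> F] --> y.
        by move=> A Ay; apply: F_cvg; exact: cvg_snd Ay.
      exact: cvg_comp F2 vinv_cvg.
    (* Applying [v] to [vinv p.1 = vinv p.2 = x] would give [p = (y, y)]. *)
    near=> p; apply/eqP => -[p1x p2x].
    have [_ p1K] : vinv p.1 \in `[a, b] /\ v (vinv p.1) = p.1 by near: p.
    have [_ p2K] : vinv p.2 \in `[a, b] /\ v (vinv p.2) = p.2 by near: p.
    have : p != (y, y) by near: p.
    by rewrite -p1x {2}p1x -p2x p1K p2K -surjective_pairing eqxx.
  near=> p.
  have [p1ab p1K] : vinv p.1 \in `[a, b] /\ v (vinv p.1) = p.1 by near: p.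
  have [p2ab p2K] : vinv p.2 \in `[a, b] /\ v (vinv p.2) = p.2 by near: p.
  have /andP[p1y p2y] : p.1 <= y <= p.2 by near: p; exact: withinT.
  have v_lt := variation_function_lt f_fv f_nonconst.
  have := p1ab; rewrite in_itv/= => /andP[-> _].
  have := p2ab; rewrite in_itv/= => /andP[_ ->]; rewrite andbT /=.
  by rewrite !leNgt -(v_lt _ _ x_cc p1ab) -(v_lt _ _ p2ab x_cc) p1K p2K -!leNgt.
apply: cvg_trans (cvg_comp _ _ k_cvg reg); apply: near_eq_cvg; near=> p.
have [p1ab p1K] : vinv p.1 \in `[a, b] /\ v (vinv p.1) = p.1 by near: p.
have [p2ab p2K] : vinv p.2 \in `[a, b] /\ v (vinv p.2) = p.2 by near: p.
by rewrite /= (oriented_variationE f_fv)// p1K p2K.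
Unshelve. all: by end_near. Qed.

(** As [g] is 1-Lipschitz near [y], the difference is nonpositive, and what remains is a lower bound
    for the distance of the two values of [g]. *)
Lemma bilaterally_metrically_regular_arclength_littleo :
  metrically_regular a b f x -> bilaterally_metrically_regular a b f x ->
  (fun p : R * R => `|g p.1 - g p.2| - 1 * `|p.1 - p.2|)
    =o_ ((y, y) : R * R) (fun p : R * R => `|p.1 - y| + `|p.2 - y|).
Proof.
move=> /metrically_regular_arclength_cvg reg.
move=> /bilaterally_metrically_regular_arclength_cvg bireg.
apply/eqoP => e e0.
(* Cleared of its denominator, the lower bound also holds at [s = y]. *)
have reg_e : \forall s \near y, (1 - e) * `|s - y| <= `|g s - g y|.
  move/cvgrPdist_le : reg => /(_ _ e0) reg.
  have {}reg : \forall s \near y, s != y ->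
    `|1 - `|g s - g y| / `|s - y| | <= e by [].
  near=> s; have [->|sy] := eqVneq s y.
    by rewrite !subrr !normr0 mulr0.
  rewrite -ler_pdivlMr ?normr_gt0 ?subr_eq0//.
  have : `|1 - `|g s - g y| / `|s - y| | <= e by move: sy; near: s.
  by rewrite ler_norml => /andP[_]; lra.
have bireg_e : \forall p \near (y, y), p.1 <= y <= p.2 ->
    (1 - e) * (p.2 - p.1) <= `|g p.1 - g p.2|.
  move/cvgrPdist_le : bireg => /(_ _ e0) bireg.
  have {}bireg : \forall p \near (y, y), p != (y, y) -> p.1 <= y <= p.2 ->
    `|1 - `|g p.1 - g p.2| / (p.2 - p.1)| <= e by [].
  near=> p => /andP[p1y yp2]; have [p12|p12] := leP p.2 p.1.
    have -> : p.2 = p.1 by apply: le_anti; rewrite p12 (le_trans p1y).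
    by rewrite !subrr normr0 mulr0.
  rewrite -ler_pdivlMr ?subr_gt0//.
  have pyy : p != (y, y).
    by apply/eqP => pE; move: p12; rewrite pE /= ltxx.
  have : `|1 - `|g p.1 - g p.2| / (p.2 - p.1)| <= e.
    have yy : p.1 <= y <= p.2 by rewrite p1y yp2.
    by move: pyy yy; near: p.
  by rewrite ler_norml => /andP[_]; lra.
(* The little-o ranges over unordered pairs, so the bilateral bound is also transported along the
   swap of coordinates. *)
have bireg_e' : \forall p \near (y, y), p.2 <= y <= p.1 ->
    (1 - e) * (p.1 - p.2) <= `|g p.1 - g p.2|.
  have swap : (p.2, p.1) @[p --> (y, y)] --> (y, y).
    apply: (@cvg_pair _ _ _ (nbhs (y, y)) (nbhs y) (nbhs y)).
      exact: cvg_snd.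
    exact: cvg_fst.
  near=> p => yy; rewrite distrC; move: yy.
  by near: p; exact: swap _ bireg_e.
have lipy : \forall s \near y, `|g s - g y| <= `|s - y|.
  apply: filterS vinvP => s [sab sK].
  by have := dist_le_variation_function f_fv sab x_cc; rewrite sK /= vinvy.
near=> p.
have lip : `|g p.1 - g p.2| <= `|p.1 - p.2|.
  by near: p; exact: arclength_lipschitz.
have lip1 : `|g p.1 - g y| <= `|p.1 - y|.
  by near: p; exact: cvg_fst lipy.
have lip2 : `|g p.2 - g y| <= `|p.2 - y|.
  by near: p; exact: cvg_snd lipy.
have reg1 : (1 - e) * `|p.1 - y| <= `|g p.1 - g y|.
  by near: p; exact: cvg_fst reg_e.
have reg2 : (1 - e) * `|p.2 - y| <= `|g p.2 - g y|.
  by near: p; exact: cvg_snd reg_e.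
have bi1 : p.1 <= y <= p.2 -> (1 - e) * (p.2 - p.1) <= `|g p.1 - g p.2|.
  by near: p.
have bi2 : p.2 <= y <= p.1 -> (1 - e) * (p.1 - p.2) <= `|g p.1 - g p.2|.
  by near: p.
have tri1 := ler_distD (g p.2) (g p.1) (g y).
have tri2 := ler_distD (g p.1) (g p.2) (g y).
rewrite (distrC (g p.2) (g p.1)) in tri2.
rewrite mul1r ler0_norm ?subr_le0// opprB.
rewrite [`| `|p.1 - y| + _|]ger0_norm ?addr_ge0//.
move: lip lip1 lip2 reg1 reg2 tri1 tri2 bi1 bi2.
move: (`|g p.1 - g p.2|) (`|g p.1 - g y|) (`|g p.2 - g y|).
move=> G G1 G2 lip lip1 lip2 reg1 reg2 tri1 tri2 bi1 bi2.
(* On opposite sides of [y], the bilateral bound is exactly the claim, as the distances to [y] add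
   up to that between the points. On the same side, the triangle inequality is combined with the
   lower bound at the point farther from [y] and the Lipschitz bound at the nearer one. *)
have [p1y|/ltW yp1] := leP p.1 y; have [p2y|/ltW yp2] := leP p.2 y.
- have n1 : `|p.1 - y| = y - p.1 by rewrite ler0_norm ?subr_le0// opprB.
  have n2 : `|p.2 - y| = y - p.2 by rewrite ler0_norm ?subr_le0// opprB.
  rewrite !(n1, n2) in lip1 lip2 reg1 reg2 *.
  by have [p12|/ltW p12] := leP p.2 p.1;
    [rewrite ger0_norm ?subr_ge0//|rewrite ler0_norm ?subr_le0//]; nra.
- have n1 : `|p.1 - y| = y - p.1 by rewrite ler0_norm ?subr_le0// opprB.
  have n2 : `|p.2 - y| = p.2 - y by rewrite ger0_norm ?subr_ge0.
  rewrite !(n1, n2) in lip1 lip2 reg1 reg2 *.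
  have {}bi1 := bi1 (introT andP (conj p1y yp2)).
  by rewrite ler0_norm ?subr_le0 ?(le_trans p1y)//; nra.
- have n1 : `|p.1 - y| = p.1 - y by rewrite ger0_norm ?subr_ge0.
  have n2 : `|p.2 - y| = y - p.2 by rewrite ler0_norm ?subr_le0// opprB.
  rewrite !(n1, n2) in lip1 lip2 reg1 reg2 *.
  have {}bi2 := bi2 (introT andP (conj p2y yp1)).
  by rewrite ger0_norm ?subr_ge0 ?(le_trans p2y)//; nra.
- have n1 : `|p.1 - y| = p.1 - y by rewrite ger0_norm ?subr_ge0.
  have n2 : `|p.2 - y| = p.2 - y by rewrite ger0_norm ?subr_ge0.
  rewrite !(n1, n2) in lip1 lip2 reg1 reg2 *.
  by have [p12|/ltW p12] := leP p.2 p.1;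
    [rewrite ger0_norm ?subr_ge0//|rewrite ler0_norm ?subr_le0//]; nra.
Unshelve. all: by end_near. Qed.

End arclength_parametrization.

Unset Implicit Arguments.

Theorem lemma5p3 (R : realType) (X : completeNormedModType R) (a b : R)
    (f : R -> X) (x : R)
    (f_cont : {within `[a, b], continuous f})
    (f_fv : finite_variation a b f)
    (f_nonconst : nonconstant_on_subintervals a b f)
    (x_ab : x \in `]a, b[) :
  let y := variation_function a f x in
  let g := f \o variation_function_inv a b f in
  (metrically_regular a b f x -> is_metric_derivative g y 1) /\
  (bilaterally_metrically_regular a b f x ->
   (exists U : set R, nbhs x U /\ forall z, U z -> metrically_regular a b f z) ->
   metrically_differentiable g y).
Proof.
move=> y g; split; first exact: metrically_regular_metric_derivative.
(* The neighbourhood [U] contains [x], so [x] itself is metrically regular and the metric derivative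
   is 1 by (i). *)
move=> bireg [U [xU Ureg]]; have reg := Ureg x (nbhs_singleton xU).
exists 1; split; first exact: metrically_regular_metric_derivative.
exact: bilaterally_metrically_regular_arclength_littleo.
Qed.
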